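(* Let $f=h\overline{g}$ be a nonvanishing logharmonic Bloch mapping in the unit disk $\mathbb{D}$ with dilatation $\omega$. Then the pre-Schwarzian norm $\|P_f\|$ of $f$ is finite if and only if $\|P_h\|$ is finite. Moreover, if $\|P_h\|$ is finite, then $$\Big|\,\|P_f\|-\|P_h\|\,\Big|\le \beta_{\log g}+1,\qquad \beta_{\log g}=\sup_{z\in\mathbb{D}}(1-|z|^2)\left|\frac{g'(z)}{g(z)}\right|,$$ and the estimate is sharp (i.e. the additive constant $1$ on the right-hand side cannot be replaced by any smaller constant valid for all such $f$).
   Context: $\mathbb{D}=\{z\in\mathbb{C}:|z|<1\}$. A nonvanishing logharmonic mapping in $\mathbb{D}$ is a function $f=h\overline{g}$ with $h,g$ nonvanishing analytic functions in $\mathbb{D}$ satisfying $g'/g=\omega\,h'/h$ for an analytic function $\omega:\mathbb{D}\to\mathbb{D}$, the dilatation of $f$ (equivalently, $\overline{f_{\overline z}}/\overline f=\omega f_z/f$). Standing assumption: $f$ is locally univalent and sense-preserving, so $h'\neq 0$ in $\mathbb{D}$ and $\omega=g'h/(gh')$. $f=h\overline g$ is a logharmonic Bloch mapping if $$\beta_f=\sup_{z\in\mathbb{D}}(1-|z|^2)\left\{\left|\frac{h'(z)}{h(z)}\right|+\left|\frac{g'(z)}{g(z)}\right|\right\}<\infty.$$ The pre-Schwarzian derivatives are $$P_f=\frac{h''}{h'}+\frac{g'}{g}-\frac{\overline{\omega}\,\omega'}{1-|\omega|^2},\qquad P_h=\frac{h''}{h'},$$ and the pre-Schwarzian norm is $\|P\|=\sup_{z\in\mathbb{D}}(1-|z|^2)|P(z)|\in[0,\infty]$.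 *)

(* Defs.v *)
From Stdlib Require Import Reals.
From Coquelicot Require Import Coquelicot.
Open Scope R_scope.

Definition in_disk (z : C) : Prop := Cmod z < 1.

(* Functions on the disk are total functions [C -> C] whose values off the disk
   are never used: every condition below is at points of the open disk, and
   derivatives there depend only on nearby values. *)
Definition analytic_disk (f : C -> C) : Prop :=
  forall z : C, in_disk z -> @ex_derive C_AbsRing C_NormedModule f z.

Definition nonvanishing_disk (f : C -> C) : Prop :=
  forall z : C, in_disk z -> f z <> RtoC 0.

Definition locally_univalent_disk (f : C -> C) : Prop :=
  forall z : C, in_disk z ->
    exists r : R, 0 < r /\
      forall u v : C, in_disk u -> in_disk v ->
        Cmod (u - z)%C < r -> Cmod (v - z)%C < r -> f u = f v -> u = v.

(* Determinant u_x v_y - u_y v_x of the real differential of f = u + i v. *)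
Definition jacobian (f : C -> C) (z : C) : R :=
  let x := fst z in
  let y := snd z in
  Derive (fun t => fst (f (t, y))) x * Derive (fun t => snd (f (x, t))) y
  - Derive (fun t => fst (f (x, t))) y * Derive (fun t => snd (f (t, y))) x.

Definition sense_preserving_disk (f : C -> C) : Prop :=
  forall z : C, in_disk z -> 0 < jacobian f z.

Definition logharm (h g : C -> C) (z : C) : C := (h z * Cconj (g z))%C.

(* For f = logharm h g the Jacobian is |h' g|^2 (1 - |w|^2), so the last
   condition forces h' <> 0 in the disk and hence w = g' h / (g h'). *)
Record logharmonic (h g w : C -> C) : Prop := {
  lh_analytic_h : analytic_disk h;
  lh_analytic_g : analytic_disk g;
  lh_nonvanishing_h : nonvanishing_disk h;
  lh_nonvanishing_g : nonvanishing_disk g;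
  lh_analytic_w : analytic_disk w;
  lh_w_disk : forall z : C, in_disk z -> in_disk (w z);
  lh_dilatation : forall z : C, in_disk z ->
    (C_derive g z / g z)%C = (w z * (C_derive h z / h z))%C;
  lh_locally_univalent : locally_univalent_disk (logharm h g);
  lh_sense_preserving : sense_preserving_disk (logharm h g)
}.

Definition disk_sup (F : C -> R) : Rbar :=
  Lub_Rbar (fun x : R =>
    exists z : C, in_disk z /\ x = (1 - Cmod z ^ 2) * F z).

Definition beta_f (h g : C -> C) : Rbar :=
  disk_sup (fun z => Cmod (C_derive h z / h z)%C + Cmod (C_derive g z / g z)%C).

Definition beta_log (g : C -> C) : Rbar :=
  disk_sup (fun z => Cmod (C_derive g z / g z)%C).

Definition logharmonic_bloch (h g w : C -> C) : Prop :=
  logharmonic h g w /\ is_finite (beta_f h g).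

Definition preSchwarzian_analytic (h : C -> C) (z : C) : C :=
  (C_derive (C_derive h) z / C_derive h z)%C.

Definition preSchwarzian_logharm (h g w : C -> C) (z : C) : C :=
  (C_derive (C_derive h) z / C_derive h z + C_derive g z / g z
   - Cconj (w z) * C_derive w z / RtoC (1 - Cmod (w z) ^ 2)%R)%C.

Definition preSchwarzian_norm (P : C -> C) : Rbar :=
  disk_sup (fun z => Cmod (P z)).

(* Main.v *)
Require Import Defs.
From Stdlib Require Import Reals Lra Lia.
From Coquelicot Require Import Coquelicot.
Open Scope R_scope.

(** The difference of the two pre-Schwarzian derivatives is
    [P_f - P_h = g'/g - conj w * w' / (1 - |w|^2)].  After multiplication by
    [1 - |z|^2] the first term is at most [beta_log g], and the second is at most
    [|w| < 1] by the Schwarz-Pick inequality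
    [(1 - |z|^2) |w'| <= 1 - |w|^2] ([schwarz_pick]).  The triangle inequality and
    suprema over the disk then give both the equivalence and the estimate
    ([preSchwarzian_norm_comparison]).

    Here analytic means complex differentiable at each point, and Schwarz-Pick is
    derived from that alone.  Goursat's subdivision argument shows that a pointwise
    differentiable closed form has zero circulation around a rectangle
    ([goursat_rectangle]).  In logarithmic coordinates a circular mean becomes an
    integral over a vertical segment of length [2 PI], and Goursat makes it
    independent of the radius; this yields the Schwarz lemma
    ([schwarz_derivative]), and composing with disk automorphisms yields
    Schwarz-Pick.

    Sharpness comes from [w = z], for which Schwarz-Pick is an equality, together
    with [h'/h] equal to a small constant [e]: then [P_h] and [g'/g] have norm at
    most [e], whereas [P_f] has norm at least [1 - 2 e]. *)

(** * Goursat's theorem for closed forms on a rectangle *)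

(** The integral of [A ds + B dt] around the boundary of the rectangle of lower
    left corner [(x, y)] and sides [l] and [m].  Opposite edges are paired under
    one integral because their integrands nearly cancel on a small rectangle. *)
Definition circulation (A B : R -> R -> R) (x y l m : R) : R :=
  RInt (fun s => A s y - A s (y + m)) x (x + l)
  + RInt (fun t => B (x + l) t - B x t) y (y + m).

Definition continuous_on_rectangle (A : R -> R -> R) (x y l m : R) : Prop :=
  forall s t, x <= s <= x + l -> y <= t <= y + m -> continuity_2d_pt A s t.

Lemma continuous_section_1 (A : R -> R -> R) (s t : R) :
  continuity_2d_pt A s t -> continuous (fun s => A s t) s.
Proof.
  intros H. apply continuity_pt_filterlim. intros e He.
  destruct (H (mkposreal e He)) as [d Hd].
  exists d; split; [apply cond_pos|].
  intros u [_ Hu]. apply Hd; [exact Hu|].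
  rewrite Rminus_diag, Rabs_R0. apply cond_pos.
Qed.

Lemma continuous_section_2 (A : R -> R -> R) (s t : R) :
  continuity_2d_pt A s t -> continuous (fun t => A s t) t.
Proof.
  intros H. apply continuity_pt_filterlim. intros e He.
  destruct (H (mkposreal e He)) as [d Hd].
  exists d; split; [apply cond_pos|].
  intros u [_ Hu]. apply Hd; [|exact Hu].
  rewrite Rminus_diag, Rabs_R0. apply cond_pos.
Qed.

Lemma ex_RInt_section_1 (A : R -> R -> R) (a b t : R) :
  a <= b -> (forall s, a <= s <= b -> continuity_2d_pt A s t) ->
  ex_RInt (fun s => A s t) a b.
Proof.
  intros Hab H. apply (ex_RInt_continuous (V := R_CompleteNormedModule)).
  intros z. rewrite Rmin_left, Rmax_right by exact Hab. intros Hz.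
  apply continuous_section_1, H, Hz.
Qed.

Lemma ex_RInt_section_2 (A : R -> R -> R) (s a b : R) :
  a <= b -> (forall t, a <= t <= b -> continuity_2d_pt A s t) ->
  ex_RInt (fun t => A s t) a b.
Proof.
  intros Hab H. apply (ex_RInt_continuous (V := R_CompleteNormedModule)).
  intros z. rewrite Rmin_left, Rmax_right by exact Hab. intros Hz.
  apply continuous_section_2, H, Hz.
Qed.

Lemma circulation_edges (A B : R -> R -> R) (x y l m : R) :
  0 <= l -> 0 <= m ->
  continuous_on_rectangle A x y l m -> continuous_on_rectangle B x y l m ->
  circulation A B x y l m =
  RInt (fun s => A s y) x (x + l) - RInt (fun s => A s (y + m)) x (x + l)
  + (RInt (fun t => B (x + l) t) y (y + m) - RInt (fun t => B x t) y (y + m)).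
Proof.
  intros Hl Hm HA HB. unfold circulation.
  f_equal; apply (RInt_minus (V := R_CompleteNormedModule)).
  - apply ex_RInt_section_1; [lra|]. intros; apply HA; lra.
  - apply (ex_RInt_section_1 A); [lra|]. intros; apply HA; lra.
  - apply ex_RInt_section_2; [lra|]. intros; apply HB; lra.
  - apply ex_RInt_section_2; [lra|]. intros; apply HB; lra.
Qed.

Lemma circulation_quarters (A B : R -> R -> R) (x y l m : R) :
  0 <= l -> 0 <= m ->
  continuous_on_rectangle A x y (l + l) (m + m) ->
  continuous_on_rectangle B x y (l + l) (m + m) ->
  circulation A B x y (l + l) (m + m) =
  circulation A B x y l m + circulation A B (x + l) y l m
  + circulation A B x (y + m) l m + circulation A B (x + l) (y + m) l m.
Proof.
  intros Hl Hm HA HB.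
  assert (HAs : forall s t, x <= s <= x + l + l -> y <= t <= y + m + m ->
    continuity_2d_pt A s t) by (intros; apply HA; lra).
  assert (HBs : forall s t, x <= s <= x + l + l -> y <= t <= y + m + m ->
    continuity_2d_pt B s t) by (intros; apply HB; lra).
  rewrite !circulation_edges; try lra;
    try (intros s t Hs Ht; first [apply HAs | apply HBs]; lra).
  rewrite <- !Rplus_assoc.
  assert (CA : forall t, y <= t <= y + m + m ->
    RInt (fun s => A s t) x (x + l + l) =
    RInt (fun s => A s t) x (x + l) + RInt (fun s => A s t) (x + l) (x + l + l)).
  { intros t Ht. symmetry.
    apply (RInt_Chasles (V := R_CompleteNormedModule));
      apply ex_RInt_section_1; try lra; intros; apply HAs; lra. }
  assert (CB : forall s, x <= s <= x + l + l ->
    RInt (fun t => B s t) y (y + m + m) =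
    RInt (fun t => B s t) y (y + m) + RInt (fun t => B s t) (y + m) (y + m + m)).
  { intros s Hs. symmetry.
    apply (RInt_Chasles (V := R_CompleteNormedModule));
      apply ex_RInt_section_2; try lra; intros; apply HBs; lra. }
  rewrite !CA, !CB by lra. ring.
Qed.

Lemma RInt_near_const (f : R -> R) (a b c e : R) :
  a <= b -> ex_RInt f a b -> (forall s, a <= s <= b -> Rabs (f s - c) <= e) ->
  Rabs (RInt f a b - c * (b - a)) <= e * (b - a).
Proof.
  intros Hab Hf H.
  assert (Hc : ex_RInt (fun _ : R => c) a b) by apply ex_RInt_const.
  replace (RInt f a b - c * (b - a)) with (RInt (fun s => f s - c) a b).
  - rewrite (Rmult_comm e). apply abs_RInt_le_const; try assumption.
    apply (ex_RInt_minus (V := R_NormedModule)); assumption.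
  - rewrite (RInt_minus (V := R_CompleteNormedModule)) by assumption.
    rewrite RInt_const. unfold minus, plus, opp, scal; simpl.
    unfold mult; simpl. ring.
Qed.

Lemma differentiable_pt_lim_continuity (A : R -> R -> R) (x y a b : R) :
  differentiable_pt_lim A x y a b -> continuity_2d_pt A x y.
Proof.
  intros H. apply differentiable_continuity_pt. exists a, b. exact H.
Qed.

(** An affine closed form has zero circulation, so only the remainders of [A] and
    [B] at [(p, q)] contribute: each is at most [e * (l + m)] and they are
    integrated over edges of total length [2 * (l + m)].  Closedness is the shared
    coefficient [a2], which makes the contributions [- a2 * m * l] and
    [a2 * l * m] of the affine parts cancel. *)
Lemma circulation_small (A B : R -> R -> R) (p q a1 a2 b2 e : R) :
  differentiable_pt_lim A p q a1 a2 -> differentiable_pt_lim B p q a2 b2 ->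
  0 < e ->
  exists d, 0 < d /\ forall x y l m, 0 <= l -> 0 <= m -> l + m < d ->
    x <= p <= x + l -> y <= q <= y + m ->
    continuous_on_rectangle A x y l m -> continuous_on_rectangle B x y l m ->
    Rabs (circulation A B x y l m) <= 2 * e * (l + m) ^ 2.
Proof.
  intros HA HB He.
  destruct (HA (mkposreal e He)) as [dA HdA].
  destruct (HB (mkposreal e He)) as [dB HdB]. simpl in HdA, HdB.
  exists (Rmin dA dB). split; [apply Rmin_pos; apply cond_pos|].
  intros x y l m Hl Hm Hd Hp Hq cA cB.
  pose proof (Rmin_l dA dB). pose proof (Rmin_r dA dB).
  assert (EA : forall s t, x <= s <= x + l -> y <= t <= y + m ->
    Rabs (A s t - A p q - (a1 * (s - p) + a2 * (t - q))) <= e * (l + m)).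
  { intros s t Hs Ht. eapply Rle_trans;
      [apply HdA; apply Rabs_def1; lra|].
    apply Rmult_le_compat_l; [lra|].
    apply Rmax_lub; apply Rabs_le; lra. }
  assert (EB : forall s t, x <= s <= x + l -> y <= t <= y + m ->
    Rabs (B s t - B p q - (a2 * (s - p) + b2 * (t - q))) <= e * (l + m)).
  { intros s t Hs Ht. eapply Rle_trans;
      [apply HdB; apply Rabs_def1; lra|].
    apply Rmult_le_compat_l; [lra|].
    apply Rmax_lub; apply Rabs_le; lra. }
  unfold circulation.
  assert (IA : Rabs (RInt (fun s => A s y - A s (y + m)) x (x + l)
                     - (- a2 * m) * (x + l - x)) <= (2 * (e * (l + m))) * (x + l - x)).
  { apply RInt_near_const; [lra| |].
    - apply (ex_RInt_minus (V := R_NormedModule));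
        apply ex_RInt_section_1; try lra; intros; apply cA; lra.
    - intros s Hs.
      pose proof (EA s y Hs ltac:(lra)) as E1.
      pose proof (EA s (y + m) Hs ltac:(lra)) as E2.
      apply Rabs_le_between in E1, E2. apply Rabs_le. lra. }
  assert (IB : Rabs (RInt (fun t => B (x + l) t - B x t) y (y + m)
                     - (a2 * l) * (y + m - y)) <= (2 * (e * (l + m))) * (y + m - y)).
  { apply RInt_near_const; [lra| |].
    - apply (ex_RInt_minus (V := R_NormedModule));
        apply ex_RInt_section_2; try lra; intros; apply cB; lra.
    - intros t Ht.
      pose proof (EB x t ltac:(lra) Ht) as E1.
      pose proof (EB (x + l) t ltac:(lra) Ht) as E2.
      apply Rabs_le_between in E1, E2. apply Rabs_le. lra. }
  apply Rabs_le_between in IA, IB. apply Rabs_le.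
  replace (x + l - x) with l in IA by ring.
  replace (y + m - y) with m in IB by ring.
  nra.
Qed.

(** Lower left corner of the [n]-th rectangle, of sides [L / 2 ^ n] and
    [M / 2 ^ n], in Goursat's nested sequence of quarters.  The first quarter on
    which [J] exceeds [eta] times the area is kept; the last one is kept by
    default, which is right as soon as some quarter qualifies. *)
Fixpoint bad_corner (J : R -> R -> R -> R -> R) (X Y L M eta : R) (n : nat)
    : R * R :=
  match n with
  | O => (X, Y)
  | S k =>
      let (x, y) := bad_corner J X Y L M eta k in
      let l := L / 2 ^ S k in
      let m := M / 2 ^ S k in
      if Rlt_dec (eta * (l * m)) (Rabs (J x y l m)) then (x, y)
      else if Rlt_dec (eta * (l * m)) (Rabs (J (x + l) y l m)) then (x + l, y)
      else if Rlt_dec (eta * (l * m)) (Rabs (J x (y + m) l m)) then (x, y + m)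
      else (x + l, y + m)
  end.

Lemma nested_intervals (u : nat -> R) (L : R) :
  0 <= L ->
  (forall n, u n <= u (S n) /\ u (S n) + L / 2 ^ S n <= u n + L / 2 ^ n) ->
  exists p, forall n, u n <= p <= u n + L / 2 ^ n.
Proof.
  intros HL H.
  assert (Hinc : forall n k, u n <= u (n + k)%nat /\
            u (n + k)%nat + L / 2 ^ (n + k) <= u n + L / 2 ^ n).
  { intros n k. induction k as [|k IH].
    - rewrite Nat.add_0_r. lra.
    - rewrite Nat.add_succ_r. specialize (H (n + k)%nat). lra. }
  assert (Hl : forall n, 0 <= L / 2 ^ n).
  { intros n. apply Rle_mult_inv_pos; [exact HL|apply pow_lt; lra]. }
  assert (Hub : forall n k, u k <= u n + L / 2 ^ n).
  { intros n k. destruct (Nat.le_ge_cases n k) as [h|h].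
    - replace k with (n + (k - n))%nat by lia.
      pose proof (Hinc n (k - n)%nat). pose proof (Hl (n + (k - n))%nat). lra.
    - pose proof (Hinc k (n - k)%nat) as [h1 _].
      replace (k + (n - k))%nat with n in h1 by lia.
      pose proof (Hl n). lra. }
  destruct (completeness (fun x => exists k, x = u k)) as [p [Hp1 Hp2]].
  - exists (u O + L / 2 ^ 0). intros x [k ->]. apply Hub.
  - exists (u O). now exists O.
  - exists p. intros n. split.
    + apply Hp1. now exists n.
    + apply Hp2. intros x [k ->]. apply Hub.
Qed.

(** Goursat's argument for a closed form that is merely differentiable at each
    point, with no continuity of the partial derivatives.  Circulation and area
    are both additive under quartering, so if the circulation is not zero some
    nested sequence of quarters keeps it above a fixed multiple [eta] of the area;
    near the limit point this contradicts [circulation_small], since all the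
    quarters have the same shape and [(l + m) ^ 2] is a fixed multiple [K] of
    their area. *)
Lemma goursat_rectangle (A B : R -> R -> R) (X Y L M : R) :
  0 < L -> 0 < M ->
  (forall s t, X <= s <= X + L -> Y <= t <= Y + M ->
     exists a1 a2 b2, differentiable_pt_lim A s t a1 a2 /\
                      differentiable_pt_lim B s t a2 b2) ->
  circulation A B X Y L M = 0.
Proof.
  intros HL HM HD.
  destruct (Req_dec (circulation A B X Y L M) 0) as [|Hne]; [assumption|exfalso].
  assert (HLM : 0 < L * M) by now apply Rmult_lt_0_compat.
  apply Rabs_pos_lt in Hne.
  set (eta := Rabs (circulation A B X Y L M) / (2 * (L * M))).
  assert (Heta : 0 < eta) by (apply Rdiv_lt_0_compat; lra).
  assert (Hstart : eta * (L * M) < Rabs (circulation A B X Y L M)).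
  { unfold eta. field_simplify; [lra|split; lra]. }
  set (c := bad_corner (circulation A B) X Y L M eta).
  assert (Hpow : forall n, 0 < 2 ^ n) by (intros; apply pow_lt; lra).
  assert (HLn : forall n, 0 < L / 2 ^ n) by (intros; apply Rdiv_lt_0_compat; auto).
  assert (HMn : forall n, 0 < M / 2 ^ n) by (intros; apply Rdiv_lt_0_compat; auto).
  assert (Half : forall Z n, Z / 2 ^ n = Z / 2 ^ S n + Z / 2 ^ S n).
  { intros Z n. simpl. specialize (Hpow n). field. lra. }
  assert (cA : continuous_on_rectangle A X Y L M).
  { intros s t Hs Ht. destruct (HD s t Hs Ht) as (a1 & a2 & b2 & h & _).
    exact (differentiable_pt_lim_continuity _ _ _ _ _ h). }
  assert (cB : continuous_on_rectangle B X Y L M).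
  { intros s t Hs Ht. destruct (HD s t Hs Ht) as (a1 & a2 & b2 & _ & h).
    exact (differentiable_pt_lim_continuity _ _ _ _ _ h). }
  assert (Inv : forall n,
    X <= fst (c n) /\ fst (c n) + L / 2 ^ n <= X + L /\
    Y <= snd (c n) /\ snd (c n) + M / 2 ^ n <= Y + M /\
    eta * (L / 2 ^ n * (M / 2 ^ n)) <
      Rabs (circulation A B (fst (c n)) (snd (c n)) (L / 2 ^ n) (M / 2 ^ n)) /\
    fst (c n) <= fst (c (S n)) /\
    fst (c (S n)) + L / 2 ^ S n <= fst (c n) + L / 2 ^ n /\
    snd (c n) <= snd (c (S n)) /\
    snd (c (S n)) + M / 2 ^ S n <= snd (c n) + M / 2 ^ n).
  { assert (Step : forall n,
      fst (c n) <= fst (c (S n)) /\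
      fst (c (S n)) + L / 2 ^ S n <= fst (c n) + L / 2 ^ n /\
      snd (c n) <= snd (c (S n)) /\
      snd (c (S n)) + M / 2 ^ S n <= snd (c n) + M / 2 ^ n).
    { intros n. rewrite (Half L n), (Half M n).
      pose proof (HLn (S n)). pose proof (HMn (S n)).
      unfold c. cbn [bad_corner]. fold c.
      destruct (c n) as [x y].
      cbv beta iota zeta.
      repeat destruct Rlt_dec; cbn [fst snd];
        repeat match goal with |- _ /\ _ => split end; lra. }
    induction n as [|n IH].
    - pose proof (Step O) as S0. rewrite !pow_O, !Rdiv_1_r in *.
      change (fst (c O)) with X in *. change (snd (c O)) with Y in *.
      repeat match goal with |- _ /\ _ => split end; lra.
    - destruct IH as (I1 & I2 & I3 & I4 & I5 & I6 & I7 & I8 & I9).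
      repeat match goal with |- _ /\ _ => split end;
        try (apply Step); try lra.
      clear I6 I7 I8 I9. revert I1 I2 I3 I4 I5.
      unfold c. cbn [bad_corner]. fold c.
      destruct (c n) as [x y].
      cbv beta iota zeta. cbn [fst snd]. intros I1 I2 I3 I4 I5.
      rewrite (Half L n) in I2, I5. rewrite (Half M n) in I4, I5.
      pose proof (HLn (S n)). pose proof (HMn (S n)).
      set (l := L / 2 ^ S n) in *. set (m := M / 2 ^ S n) in *.
      rewrite circulation_quarters in I5; try lra;
        try (intros s t Hs Ht; first [apply cA | apply cB]; lra).
      repeat destruct Rlt_dec; cbn [fst snd]; try assumption.
      pose proof (Rabs_triang
        (circulation A B x y l m + circulation A B (x + l) y l m
         + circulation A B x (y + m) l m) (circulation A B (x + l) (y + m) l m)).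
      pose proof (Rabs_triang
        (circulation A B x y l m + circulation A B (x + l) y l m)
        (circulation A B x (y + m) l m)).
      pose proof (Rabs_triang
        (circulation A B x y l m) (circulation A B (x + l) y l m)).
      lra. }
  destruct (nested_intervals (fun n => fst (c n)) L) as [p Hp];
    [lra| intros n; pose proof (Inv n); lra |].
  destruct (nested_intervals (fun n => snd (c n)) M) as [q Hq];
    [lra| intros n; pose proof (Inv n); lra |].
  destruct (HD p q) as (a1 & a2 & b2 & dA & dB).
  { specialize (Hp O). simpl in Hp. rewrite Rdiv_1_r in Hp. exact Hp. }
  { specialize (Hq O). simpl in Hq. rewrite Rdiv_1_r in Hq. exact Hq. }
  (* The ratio of [(l + m) ^ 2] to [l * m], the same for every quarter. *)
  set (K := (L + M) ^ 2 / (L * M)).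
  assert (HK : 0 < K) by (apply Rdiv_lt_0_compat; nra).
  destruct (circulation_small A B p q a1 a2 b2 (eta / (2 * K)) dA dB)
    as [d [Hd Hsmall]].
  { apply Rdiv_lt_0_compat; lra. }
  destruct (Pow_x_infinity 2) with (b := (L + M) / d + 1) as [N HN].
  { rewrite Rabs_pos_eq; lra. }
  specialize (HN N (Nat.le_refl N)).
  rewrite Rabs_pos_eq in HN by (apply Rlt_le, Hpow).
  destruct (Inv N) as (I1 & I2 & I3 & I4 & I5 & _).
  refine (Rlt_irrefl _ (Rlt_le_trans _ _ _ I5 _)).
  eapply Rle_trans.
  - apply Hsmall.
    + apply Rlt_le, HLn.
    + apply Rlt_le, HMn.
    + rewrite <- Rdiv_plus_distr. apply Rlt_div_l; [apply Hpow|].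
      rewrite Rmult_comm. apply Rlt_div_l; [exact Hd|]. lra.
    + apply Hp.
    + apply Hq.
    + intros s t Hs Ht. apply cA; lra.
    + intros s t Hs Ht. apply cB; lra.
  - right. unfold K. specialize (Hpow N). field. repeat split; nra.
Qed.

(** * Complex derivatives *)

Definition is_C_derive (f : C -> C) (z l : C) : Prop :=
  @is_derive C_AbsRing C_NormedModule f z l.

Lemma is_C_derive_eps (f : C -> C) (z l : C) :
  is_C_derive f z l <->
  forall e, 0 < e -> exists d, 0 < d /\ forall y : C, Cmod (y - z)%C < d ->
    Cmod (f y - f z - (y - z) * l)%C <= e * Cmod (y - z)%C.
Proof.
  split.
  - intros [_ H] e He.
    destruct (H z (fun P HP => HP) (mkposreal e He)) as [d Hd].
    exists d. split; [apply cond_pos|]. intros y Hy. exact (Hd y Hy).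
  - intros H. split.
    + apply (is_linear_scal_l (K := C_AbsRing) (V := C_NormedModule) l).
    + intros x Hx e.
      apply (is_filter_lim_locally_unique (K := C_AbsRing)
        (V := AbsRing_NormedModule C_AbsRing)) in Hx.
      subst x. destruct (H e (cond_pos e)) as [d [Hd1 Hd2]].
      exists (mkposreal d Hd1). intros y Hy. exact (Hd2 y Hy).
Qed.

(** [C] carries two normed module structures over itself, with different uniform
    structures but the same norm.  The product and chain rules live in the one on
    the right, [C_derive] in the other. *)
Lemma is_C_derive_self (f : C -> C) (z l : C) :
  is_C_derive f z l <-> @is_derive C_AbsRing (AbsRing_NormedModule C_AbsRing) f z l.
Proof.
  rewrite is_C_derive_eps. split.
  - intros H. split.
    + apply (is_linear_scal_l (K := C_AbsRing) (V := AbsRing_NormedModule C_AbsRing) l).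
    + intros x Hx e.
      apply (is_filter_lim_locally_unique (K := C_AbsRing)
        (V := AbsRing_NormedModule C_AbsRing)) in Hx.
      subst x. destruct (H e (cond_pos e)) as [d [Hd1 Hd2]].
      exists (mkposreal d Hd1). intros y Hy. exact (Hd2 y Hy).
  - intros [_ H] e He.
    destruct (H z (fun P HP => HP) (mkposreal e He)) as [d Hd].
    exists d. split; [apply cond_pos|]. intros y Hy. exact (Hd y Hy).
Qed.

Lemma is_C_derive_comp (f g : C -> C) (z df dg : C) :
  is_C_derive f (g z) df -> is_C_derive g z dg ->
  is_C_derive (fun y => f (g y)) z (dg * df)%C.
Proof.
  intros Hf Hg. apply is_C_derive_self in Hg.
  exact (is_derive_comp (V := C_NormedModule) f g z df dg Hf Hg).
Qed.

Lemma is_C_derive_mult (f g : C -> C) (z df dg : C) :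
  is_C_derive f z df -> is_C_derive g z dg ->
  is_C_derive (fun y => f y * g y)%C z (df * g z + f z * dg)%C.
Proof.
  rewrite !is_C_derive_self. intros Hf Hg.
  exact (is_derive_mult (K := C_AbsRing) f g z df dg Hf Hg Cmult_comm).
Qed.

Lemma is_C_derive_plus (f g : C -> C) (z df dg : C) :
  is_C_derive f z df -> is_C_derive g z dg ->
  is_C_derive (fun y => f y + g y)%C z (df + dg)%C.
Proof. exact (is_derive_plus (V := C_NormedModule) f g z df dg). Qed.

Lemma is_C_derive_const (c z : C) : is_C_derive (fun _ => c) z (RtoC 0).
Proof. exact (is_derive_const (V := C_NormedModule) c z). Qed.

Lemma is_C_derive_id (z : C) : is_C_derive (fun y => y) z (RtoC 1).
Proof. apply is_C_derive_self, (is_derive_id (K := C_AbsRing)). Qed.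

Lemma is_C_derive_ext (f g : C -> C) (z l : C) :
  (forall y, f y = g y) -> is_C_derive f z l -> is_C_derive g z l.
Proof. exact (is_derive_ext (V := C_NormedModule) f g z l). Qed.

Lemma is_C_derive_affine (a b z : C) : is_C_derive (fun y => a * y + b)%C z a.
Proof.
  pose proof (is_C_derive_plus _ _ z _ _
    (is_C_derive_mult _ _ z _ _ (is_C_derive_const a z) (is_C_derive_id z))
    (is_C_derive_const b z)) as H.
  cbv beta in H. replace (RtoC 0 * z + a * RtoC 1 + RtoC 0)%C with a in H by ring.
  exact H.
Qed.

Lemma is_C_derive_inv (z : C) :
  z <> RtoC 0 -> is_C_derive Cinv z (- / (z * z))%C.
Proof.
  intros Hz. apply is_C_derive_eps. intros e He.
  assert (Hm := proj1 (Cmod_gt_0 z) Hz).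
  set (r := Cmod z) in *.
  exists (Rmin (r / 2) (e * r ^ 3 / 2)). split.
  { assert (0 < r ^ 3) by (apply pow_lt; lra). apply Rmin_pos; nra. }
  intros y Hy.
  assert (H1 : Cmod (y - z)%C < r / 2) by (eapply Rlt_le_trans; [exact Hy|apply Rmin_l]).
  assert (H2 : Cmod (y - z)%C < e * r ^ 3 / 2)
    by (eapply Rlt_le_trans; [exact Hy|apply Rmin_r]).
  assert (H3 : r / 2 < Cmod y).
  { pose proof (Cmod_triangle y (- (y - z))%C) as T.
    rewrite Cmod_opp in T. replace (y + - (y - z))%C with z in T by ring.
    fold r in T. lra. }
  assert (Hy0 : y <> RtoC 0) by (apply Cmod_gt_0; lra).
  replace (/ y - / z - (y - z) * - / (z * z))%C
    with ((y - z) * (y - z) * / (y * (z * z)))%C by (field; split; assumption).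
  rewrite !Cmod_mult, Cmod_inv, !Cmod_mult by (repeat apply Cmult_neq_0; assumption).
  fold r. set (t := Cmod (y - z)%C) in *.
  assert (0 <= t) by apply Cmod_ge_0.
  assert (Hden : 0 < Cmod y * (r * r)) by (repeat apply Rmult_lt_0_compat; lra).
  apply Rmult_le_reg_r with (Cmod y * (r * r)); [exact Hden|].
  replace (t * t * / (Cmod y * (r * r)) * (Cmod y * (r * r))) with (t * t) by (field; lra).
  assert (t <= e * (Cmod y * (r * r))).
  { assert (r * r * (r / 2) <= r * r * Cmod y) by (apply Rmult_le_compat_l; nra).
    nra. }
  nra.
Qed.

(** The Cauchy-Riemann equations, in the pointwise form that turns a complex
    differentiable function into the closed forms of [goursat_rectangle]. *)
Lemma is_C_derive_iff_CR (f : C -> C) (x y p q : R) :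
  is_C_derive f (x, y) (p, q) <->
  differentiable_pt_lim (fun s t => fst (f (s, t))) x y p (- q) /\
  differentiable_pt_lim (fun s t => snd (f (s, t))) x y q p.
Proof.
  rewrite is_C_derive_eps.
  assert (Hs : 0 < sqrt 2) by (apply sqrt_lt_R0; lra).
  assert (Hle : forall a b, Cmod (a, b) <= sqrt 2 * Rmax (Rabs a) (Rabs b))
    by (intros; apply (Cmod_2Rmax (a, b))).
  assert (Hge : forall a b, Rabs a <= Cmod (a, b) /\ Rabs b <= Cmod (a, b)).
  { intros a b. pose proof (Rmax_Cmod (a, b)) as h. simpl in h.
    pose proof (Rmax_l (Rabs a) (Rabs b)). pose proof (Rmax_r (Rabs a) (Rabs b)). lra. }
  assert (Rem : forall s t,
    (f (s, t) - f (x, y) - ((s, t) - (x, y)) * (p, q))%C =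
    (fst (f (s, t)) - fst (f (x, y)) - (p * (s - x) + - q * (t - y)),
     snd (f (s, t)) - snd (f (x, y)) - (q * (s - x) + p * (t - y)))).
  { intros s t. unfold Cminus, Cplus, Copp, Cmult. simpl. f_equal; ring. }
  assert (Dif : forall s t, ((s, t) - (x, y))%C = (s - x, t - y)) by reflexivity.
  split.
  - intros H.
    assert (E : forall e : posreal, locally_2d (fun s t =>
      Cmod (f (s, t) - f (x, y) - ((s, t) - (x, y)) * (p, q))%C
      <= e * Rmax (Rabs (s - x)) (Rabs (t - y))) x y).
    { intros e. destruct (H (e / sqrt 2)) as [d [Hd H1]].
      { apply Rdiv_lt_0_compat; [apply cond_pos|exact Hs]. }
      assert (Hd' : 0 < d / sqrt 2) by (apply Rdiv_lt_0_compat; assumption).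
      exists (mkposreal _ Hd'). simpl. intros s t Hu Hv.
      pose proof (Hle (s - x) (t - y)) as B.
      eapply Rle_trans; [apply H1|].
      - rewrite Dif. eapply Rle_lt_trans; [exact B|].
        rewrite Rmult_comm. apply Rlt_div_r; [exact Hs|].
        apply Rmax_lub_lt; assumption.
      - rewrite Dif. apply Rle_trans with
          (e / sqrt 2 * (sqrt 2 * Rmax (Rabs (s - x)) (Rabs (t - y)))).
        + apply Rmult_le_compat_l; [|exact B].
          apply Rlt_le, Rdiv_lt_0_compat; [apply cond_pos|exact Hs].
        + right. field. lra. }
    split; intros e; destruct (E e) as [d Hd]; exists d; intros s t Hu Hv;
      specialize (Hd s t Hu Hv); rewrite Rem in Hd;
      (eapply Rle_trans; [|exact Hd]); apply Hge.
  - intros [H1 H2] e He.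
    assert (He' : 0 < e / sqrt 2) by (apply Rdiv_lt_0_compat; assumption).
    destruct (H1 (mkposreal _ He')) as [d1 Hd1].
    destruct (H2 (mkposreal _ He')) as [d2 Hd2]. simpl in Hd1, Hd2.
    exists (Rmin d1 d2). split; [apply Rmin_pos; apply cond_pos|].
    intros [s t]. rewrite Rem, Dif. intros Hd.
    pose proof (Rmin_l d1 d2). pose proof (Rmin_r d1 d2).
    destruct (Hge (s - x) (t - y)) as [G1 G2].
    specialize (Hd1 s t ltac:(lra) ltac:(lra)).
    specialize (Hd2 s t ltac:(lra) ltac:(lra)).
    eapply Rle_trans; [apply Hle|].
    apply Rle_trans with
      (sqrt 2 * (e / sqrt 2 * Rmax (Rabs (s - x)) (Rabs (t - y)))).
    + apply Rmult_le_compat_l; [lra|]. apply Rmax_lub; assumption.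
    + replace (sqrt 2 * (e / sqrt 2 * Rmax (Rabs (s - x)) (Rabs (t - y))))
        with (e * Rmax (Rabs (s - x)) (Rabs (t - y))) by (field; lra).
      apply Rmult_le_compat_l; [lra|]. apply Rmax_lub; assumption.
Qed.

(** * The complex exponential *)

Definition Cexp (z : C) : C :=
  (exp (fst z) * cos (snd z), exp (fst z) * sin (snd z)).

Lemma Cexp_plus (z w : C) : Cexp (z + w)%C = (Cexp z * Cexp w)%C.
Proof.
  destruct z as [a b], w as [c d]. unfold Cexp, Cplus, Cmult; simpl.
  rewrite exp_plus, cos_plus, sin_plus. f_equal; ring.
Qed.

Lemma Cmod_Cexp (z : C) : Cmod (Cexp z) = exp (fst z).
Proof.
  unfold Cmod, Cexp; simpl.
  replace (_ + _) with (Rsqr (exp (fst z)) * (Rsqr (sin (snd z)) + Rsqr (cos (snd z))))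
    by (unfold Rsqr; ring).
  rewrite sin2_cos2, Rmult_1_r. apply sqrt_Rsqr. apply Rlt_le, exp_pos.
Qed.

Lemma Cexp_neq_0 (z : C) : Cexp z <> RtoC 0.
Proof. apply Cmod_gt_0. rewrite Cmod_Cexp. apply exp_pos. Qed.

Lemma differentiable_pt_lim_mul (x y : R) : differentiable_pt_lim Rmult x y y x.
Proof.
  intros e. exists e. intros u v Hu Hv.
  replace (u * v - x * y - (y * (u - x) + x * (v - y)))
    with ((u - x) * (v - y)) by ring.
  rewrite Rabs_mult. apply Rmult_le_compat; try apply Rabs_pos.
  - lra.
  - apply Rmax_r.
Qed.

Lemma differentiable_pt_lim_prod (f g : R -> R) (x y a b : R) :
  derivable_pt_lim f x a -> derivable_pt_lim g y b ->
  differentiable_pt_lim (fun s t => f s * g t) x y (a * g y) (f x * b).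
Proof.
  intros Hf Hg.
  assert (Hg' : differentiable_pt_lim (fun _ t => g t) x y 0 b).
  { intros e. destruct (differentiable_pt_lim_proj1_0 g y x b Hg e) as [d Hd].
    exists d. intros u v Hu Hv. specialize (Hd v u Hv Hu).
    rewrite Rmax_comm.
    replace (0 * (u - x) + b * (v - y)) with (b * (v - y) + 0 * (u - x)) by ring.
    exact Hd. }
  pose proof (differentiable_pt_lim_comp Rmult (fun s _ => f s) (fun _ t => g t) x y
    (g y) (f x) a 0 0 b (differentiable_pt_lim_mul _ _)
    (differentiable_pt_lim_proj1_0 f x y a Hf) Hg') as H.
  replace (a * g y) with (g y * a + f x * 0) by ring.
  replace (f x * b) with (g y * 0 + f x * b) by ring. exact H.
Qed.

Lemma is_C_derive_Cexp (z : C) : is_C_derive Cexp z (Cexp z).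
Proof.
  destruct z as [x y]. unfold Cexp at 2. simpl.
  apply is_C_derive_iff_CR. simpl. split.
  - rewrite Ropp_mult_distr_r.
    apply (differentiable_pt_lim_prod exp cos);
      [apply derivable_pt_lim_exp | apply derivable_pt_lim_cos].
  - apply (differentiable_pt_lim_prod exp sin);
      [apply derivable_pt_lim_exp | apply derivable_pt_lim_sin].
Qed.

(** * The Schwarz lemma and its invariant form *)

Lemma in_disk_0 : in_disk (RtoC 0).
Proof. unfold in_disk. rewrite Cmod_0. lra. Qed.

Lemma disk_weight_pos (z : C) : in_disk z -> 0 < 1 - Cmod z ^ 2.
Proof. unfold in_disk. pose proof (Cmod_ge_0 z). nra. Qed.

(** The function [F z / z] is pulled back by the exponential to
    [H z = F (Cexp z) * Cexp (- z)], analytic on the left half-plane and periodic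
    of period [2 i PI].  Goursat on a rectangle of height [2 PI] gives the mean
    value property without any path around the origin: the horizontal edges
    cancel, so the mean of [Re H] over a vertical segment does not depend on the
    abscissa [s].  Near [s = 0] that mean is at most [exp (- s)], close to 1; as [s]
    goes to minus infinity it tends to [Re (F' 0)]. *)
Lemma schwarz_derivative_re (F : C -> C) (l : C) :
  (forall z, in_disk z -> exists dF, is_C_derive F z dF) ->
  (forall z, in_disk z -> in_disk (F z)) ->
  F (RtoC 0) = RtoC 0 -> is_C_derive F (RtoC 0) l -> fst l <= 1.
Proof.
  intros HF Hdisk F0 Hl. destruct (Rle_lt_dec (fst l) 1) as [|Hk]; [assumption|exfalso].
  set (k := fst l) in *.
  set (H := fun z : C => (F (Cexp z) * Cexp (- z))%C).
  assert (Hexp : forall x y, x < 0 -> in_disk (Cexp (x, y))).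
  { intros x y Hx. unfold in_disk. rewrite Cmod_Cexp. simpl.
    rewrite <- exp_0. apply exp_increasing, Hx. }
  assert (Hinv : forall z, (Cexp z * Cexp (- z))%C = RtoC 1).
  { intros z. rewrite <- Cexp_plus. replace (z + - z)%C with (RtoC 0) by ring.
    unfold Cexp; simpl. rewrite exp_0, cos_0, sin_0. unfold RtoC. f_equal; ring. }
  assert (Hd : forall x y, x < 0 -> exists p q,
    differentiable_pt_lim (fun s t => fst (H (s, t))) x y p (- q) /\
    differentiable_pt_lim (fun s t => snd (H (s, t))) x y q p).
  { intros x y Hx. destruct (HF _ (Hexp x y Hx)) as [dF HdF].
    assert (D : exists dH, is_C_derive H (x, y) dH).
    { eexists. unfold H. apply is_C_derive_mult.
      - apply is_C_derive_comp; [exact HdF|apply is_C_derive_Cexp].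
      - apply (is_C_derive_comp Cexp Copp); [apply is_C_derive_Cexp|].
        apply (is_C_derive_ext (fun y => (- RtoC 1) * y + RtoC 0)%C);
          [intros; ring|apply is_C_derive_affine]. }
    destruct D as [[p q] D]. exists p, q. apply is_C_derive_iff_CR, D. }
  (* On the line of abscissa [s0], [|F z / z|] is at most [exp (- s0)], which is
     halfway between 1 and [k]. *)
  set (s0 := - ln ((1 + k) / 2)).
  assert (Hs0 : s0 < 0).
  { unfold s0. assert (0 < ln ((1 + k) / 2)); [|lra].
    rewrite <- ln_1. apply ln_increasing; lra. }
  assert (Outer : forall t, fst (H (s0, t)) <= (1 + k) / 2).
  { intros t. eapply Rle_trans; [apply Rle_abs|].
    eapply Rle_trans; [apply (re_le_Cmod (H (s0, t)))|]. unfold H.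
    rewrite Cmod_mult, Cmod_Cexp. simpl. unfold s0 at 2.
    rewrite Ropp_involutive, exp_ln by lra.
    pose proof (Hdisk _ (Hexp s0 t Hs0)) as h. unfold in_disk in h. nra. }
  destruct (proj1 (is_C_derive_eps F (RtoC 0) l) Hl ((k - 1) / 4)) as [d [Hd0 Hd1]];
    [lra|].
  (* On the line of abscissa [s1], [z] is so small that [F z / z] is within
     [(k - 1) / 4] of [F' 0]. *)
  set (s1 := Rmin (s0 - 1) (ln (d / 2))).
  assert (Hs1 : s1 < s0) by (unfold s1; pose proof (Rmin_l (s0 - 1) (ln (d / 2))); lra).
  assert (Hs1d : exp s1 < d).
  { apply Rle_lt_trans with (exp (ln (d / 2))).
    - destruct (Rmin_r (s0 - 1) (ln (d / 2))) as [h|h];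
        [left; apply exp_increasing, h | right; unfold s1; now rewrite h].
    - rewrite exp_ln; lra. }
  assert (Inner : forall t, k - (k - 1) / 4 <= fst (H (s1, t))).
  { intros t. set (z := Cexp (s1, t)).
    assert (Hz : Cmod z = exp s1) by apply Cmod_Cexp.
    specialize (Hd1 z). rewrite F0 in Hd1.
    replace (z - RtoC 0)%C with z in Hd1 by ring.
    specialize (Hd1 ltac:(lra)).
    assert (E : Cmod (H (s1, t) - l)%C <= (k - 1) / 4).
    { replace (H (s1, t) - l)%C with
        ((F z - RtoC 0 - z * l) * Cexp (- (s1, t)))%C.
      - rewrite Cmod_mult, Cmod_Cexp. simpl. rewrite Hz in Hd1.
        apply Rmult_le_reg_r with (exp s1); [apply exp_pos|].
        rewrite Rmult_assoc, <- exp_plus, Rplus_opp_l, exp_0. lra.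
      - unfold H. fold z.
        replace l with (l * (z * Cexp (- (s1, t))))%C at 2
          by (unfold z; rewrite Hinv; ring). ring. }
    pose proof (re_le_Cmod (H (s1, t) - l)%C) as R1.
    assert (R2 : Rabs (fst (H (s1, t)) - k) <= (k - 1) / 4)
      by (eapply Rle_trans; [exact R1|exact E]).
    apply Rabs_le_between in R2. lra. }
  assert (HPI := PI_RGT_0).
  assert (G := goursat_rectangle (fun s t => snd (H (s, t))) (fun s t => fst (H (s, t)))
    s1 0 (s0 - s1) (2 * PI) ltac:(lra) ltac:(lra)).
  assert (G0 : forall s t, s1 <= s <= s1 + (s0 - s1) -> 0 <= t <= 0 + 2 * PI ->
     exists a1 a2 b2 : R,
       differentiable_pt_lim (fun s t => snd (H (s, t))) s t a1 a2 /\
       differentiable_pt_lim (fun s t => fst (H (s, t))) s t a2 b2).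
  { intros s t Hs _. destruct (Hd s t ltac:(lra)) as (p & q & D1 & D2).
    exists q, p, (- q). split; assumption. }
  specialize (G G0). unfold circulation in G.
  rewrite (RInt_ext _ (fun _ => 0)) in G.
  2:{ intros s _. unfold H, Cexp; simpl.
      rewrite Rplus_0_l, Ropp_0, cos_neg, sin_neg, cos_2PI, sin_2PI, cos_0, sin_0, Ropp_0.
      ring. }
  rewrite RInt_const in G.
  replace (s1 + (s0 - s1)) with s0 in * by ring. rewrite Rplus_0_l in *.
  assert (I : forall s, s1 <= s <= s0 -> ex_RInt (fun t => fst (H (s, t))) 0 (2 * PI)).
  { intros s Hs. apply (ex_RInt_section_2 (fun s t => fst (H (s, t)))); [lra|].
    intros t Ht. destruct (Hd s t ltac:(lra)) as (p & q & D1 & _).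
    exact (differentiable_pt_lim_continuity _ _ _ _ _ D1). }
  assert (U : RInt (fun t => fst (H (s0, t)) - fst (H (s1, t))) 0 (2 * PI)
              <= RInt (fun _ => - ((k - 1) / 4)) 0 (2 * PI)).
  { apply RInt_le.
    - lra.
    - apply (ex_RInt_minus (V := R_NormedModule)); apply I; lra.
    - apply ex_RInt_const.
    - intros t _. pose proof (Outer t). pose proof (Inner t). lra. }
  rewrite RInt_const in U.
  unfold scal in G, U; simpl in G, U. unfold mult in G, U; simpl in G, U.
  nra.
Qed.

(** A rotation of [F] makes its derivative at the origin a positive real. *)
Lemma schwarz_derivative (F : C -> C) (l : C) :
  (forall z, in_disk z -> exists dF, is_C_derive F z dF) ->
  (forall z, in_disk z -> in_disk (F z)) ->
  F (RtoC 0) = RtoC 0 -> is_C_derive F (RtoC 0) l -> Cmod l <= 1.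
Proof.
  intros HF Hdisk F0 Hl.
  destruct (Rle_lt_dec (Cmod l) 1) as [|Hk]; [assumption|].
  assert (Hl0 : RtoC (Cmod l) <> RtoC 0) by (intros E; apply RtoC_inj in E; lra).
  set (u := (Cconj l / Cmod l)%C).
  assert (Hu : Cmod u = 1).
  { unfold u. rewrite Cmod_div, Cmod_conj, Cmod_R, Rabs_pos_eq by (assumption || lra).
    field. lra. }
  assert (Hul : (u * l)%C = RtoC (Cmod l)).
  { unfold u. replace (Cconj l / Cmod l * l)%C with (l * Cconj l / Cmod l)%C
      by (field; assumption).
    rewrite <- Cmod2_conj. rewrite RtoC_pow. field. assumption. }
  replace (Cmod l) with (fst (u * l)%C) by (rewrite Hul; reflexivity).
  assert (D : forall z dF, is_C_derive F z dF ->
    is_C_derive (fun y => u * F y + RtoC 0)%C z (u * dF)%C).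
  { intros z dF h. replace (u * dF)%C with (dF * u)%C by ring.
    exact (is_C_derive_comp (fun y => u * y + RtoC 0)%C F z u dF
             (is_C_derive_affine _ _ _) h). }
  apply (schwarz_derivative_re (fun z => u * F z + RtoC 0)%C).
  - intros z Hz. destruct (HF z Hz) as [dF h]. exists (u * dF)%C. now apply D.
  - intros z Hz. unfold in_disk. replace (u * F z + RtoC 0)%C with (u * F z)%C by ring.
    rewrite Cmod_mult, Hu, Rmult_1_l. now apply Hdisk.
  - rewrite F0. ring.
  - now apply D.
Qed.

Definition mobius (a z : C) : C := ((z + a) / (RtoC 1 + Cconj a * z))%C.

(** The identity behind every property of [mobius a] on the disk: it keeps the
    denominator away from 0 and the quotient inside the disk. *)
Lemma mobius_Cmod (a z : C) :
  Cmod (RtoC 1 + Cconj a * z)%C ^ 2 - Cmod (z + a)%C ^ 2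
  = (1 - Cmod a ^ 2) * (1 - Cmod z ^ 2).
Proof.
  rewrite !Cmod2_alt. destruct a, z. simpl. ring.
Qed.

Lemma mobius_den (a z : C) :
  in_disk a -> in_disk z -> 0 < Cmod (RtoC 1 + Cconj a * z)%C.
Proof.
  unfold in_disk. intros Ha Hz.
  pose proof (mobius_Cmod a z). pose proof (Cmod_ge_0 a). pose proof (Cmod_ge_0 z).
  assert (0 < (1 - Cmod a ^ 2) * (1 - Cmod z ^ 2)) by (apply Rmult_lt_0_compat; nra).
  pose proof (Cmod_ge_0 (RtoC 1 + Cconj a * z)%C).
  pose proof (pow2_ge_0 (Cmod (z + a)%C)). nra.
Qed.

Lemma mobius_disk (a z : C) : in_disk a -> in_disk z -> in_disk (mobius a z).
Proof.
  intros Ha Hz. pose proof (mobius_den a z Ha Hz) as Hden.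
  unfold in_disk, mobius in *. rewrite Cmod_div by (now apply Cmod_gt_0).
  apply Rlt_div_l; [exact Hden|]. rewrite Rmult_1_l.
  pose proof (mobius_Cmod a z). pose proof (Cmod_ge_0 a). pose proof (Cmod_ge_0 z).
  assert (0 < (1 - Cmod a ^ 2) * (1 - Cmod z ^ 2)) by (apply Rmult_lt_0_compat; nra).
  pose proof (Cmod_ge_0 (z + a)%C). nra.
Qed.

Lemma is_C_derive_mobius (a z : C) :
  in_disk a -> in_disk z ->
  is_C_derive (mobius a) z
    (RtoC (1 - Cmod a ^ 2) / (RtoC 1 + Cconj a * z) ^ 2)%C.
Proof.
  intros Ha Hz. pose proof (proj2 (Cmod_gt_0 _) (mobius_den a z Ha Hz)) as Hden.
  replace (RtoC (1 - Cmod a ^ 2)) with (RtoC 1 - a * Cconj a)%C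
    by (rewrite <- Cmod2_conj, <- RtoC_minus; reflexivity).
  apply (is_C_derive_ext (fun z => (RtoC 1 * z + a) * / (Cconj a * z + RtoC 1))%C).
  { intros y. unfold mobius, Cdiv. f_equal; [|f_equal]; ring. }
  replace ((RtoC 1 - a * Cconj a) / (RtoC 1 + Cconj a * z) ^ 2)%C with
    (RtoC 1 * / (Cconj a * z + RtoC 1) +
     (RtoC 1 * z + a) * (Cconj a * - / ((Cconj a * z + RtoC 1) * (Cconj a * z + RtoC 1))))%C.
  - apply (is_C_derive_mult (fun y => RtoC 1 * y + a)%C
      (fun y => / (Cconj a * y + RtoC 1))%C); [apply is_C_derive_affine|].
    apply (is_C_derive_comp Cinv (fun y => Cconj a * y + RtoC 1)%C);
      [|apply is_C_derive_affine].
    apply is_C_derive_inv. rewrite Cplus_comm. exact Hden.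
  - field. exact Hden.
Qed.

(** Conjugating [w] by disk automorphisms that send 0 to [a] and [w a] to 0 reduces
    the inequality to the Schwarz lemma at the origin. *)
Lemma schwarz_pick (w : C -> C) (a l : C) :
  (forall z, in_disk z -> exists dw, is_C_derive w z dw) ->
  (forall z, in_disk z -> in_disk (w z)) ->
  in_disk a -> is_C_derive w a l ->
  (1 - Cmod a ^ 2) * Cmod l <= 1 - Cmod (w a) ^ 2.
Proof.
  intros Hw Hdisk Ha Hl.
  assert (Hb := Hdisk a Ha). set (b := w a) in *.
  assert (Hmb : in_disk (- b)%C) by (unfold in_disk; rewrite Cmod_opp; exact Hb).
  assert (Ma0 : mobius a (RtoC 0) = a).
  { unfold mobius. field. }
  assert (HA := disk_weight_pos a Ha).
  assert (HB := disk_weight_pos b Hb).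
  assert (D : forall z dw, in_disk z -> is_C_derive w (mobius a z) dw ->
    is_C_derive (fun y => mobius (- b) (w (mobius a y))) z
     ((RtoC (1 - Cmod a ^ 2) / (RtoC 1 + Cconj a * z) ^ 2 * dw)
      * (RtoC (1 - Cmod (- b) ^ 2) / (RtoC 1 + Cconj (- b) * w (mobius a z)) ^ 2))%C).
  { intros z dw Hz h.
    apply (is_C_derive_comp (mobius (- b)) (fun y => w (mobius a y))).
    - apply is_C_derive_mobius; [exact Hmb|]. now apply Hdisk, mobius_disk.
    - apply (is_C_derive_comp w (mobius a)); [exact h|]. now apply is_C_derive_mobius. }
  assert (S : Cmod ((RtoC (1 - Cmod a ^ 2) / (RtoC 1 + Cconj a * RtoC 0) ^ 2 * l)
      * (RtoC (1 - Cmod (- b) ^ 2) / (RtoC 1 + Cconj (- b) * b) ^ 2))%C <= 1).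
  { apply (schwarz_derivative (fun y => mobius (- b) (w (mobius a y)))).
    - intros z Hz. destruct (Hw (mobius a z)) as [dw h]; [now apply mobius_disk|].
      eexists. apply D; eassumption.
    - intros z Hz. apply mobius_disk; [exact Hmb|]. now apply Hdisk, mobius_disk.
    - rewrite Ma0. fold b. unfold mobius, Cdiv. ring.
    - pose proof (D (RtoC 0) l in_disk_0) as D0. rewrite Ma0 in D0. fold b in D0.
      apply D0, Hl. }
  replace (RtoC 1 + Cconj (- b) * b)%C with (RtoC (1 - Cmod b ^ 2)) in S.
  2:{ rewrite Copp_conj, RtoC_minus, Cmod2_conj. ring. }
  replace (RtoC 1 + Cconj a * RtoC 0)%C with (RtoC 1) in S by ring.
  rewrite Cmod_opp in S.
  assert (HBC : RtoC (1 - Cmod b ^ 2) <> RtoC 0) by (intros E; apply RtoC_inj in E; lra).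
  replace (RtoC (1 - Cmod a ^ 2) / RtoC 1 ^ 2 * l *
         (RtoC (1 - Cmod b ^ 2) / RtoC (1 - Cmod b ^ 2) ^ 2))%C
   with (RtoC (1 - Cmod a ^ 2) * l / RtoC (1 - Cmod b ^ 2))%C in S
   by (field; assumption).
  rewrite Cmod_div, Cmod_mult, !Cmod_R, !Rabs_pos_eq in S by (assumption || lra).
  apply Rle_div_l in S; lra.
Qed.

(** * Comparison of the pre-Schwarzian norms *)

Lemma disk_sup_upper (F : C -> R) (z : C) :
  is_finite (disk_sup F) -> in_disk z -> (1 - Cmod z ^ 2) * F z <= real (disk_sup F).
Proof.
  intros Hfin Hz. destruct (Lub_Rbar_correct (fun x : R =>
    exists z : C, in_disk z /\ x = (1 - Cmod z ^ 2) * F z)) as [Hub _].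
  fold (disk_sup F) in Hub. specialize (Hub _ (ex_intro _ z (conj Hz eq_refl))).
  rewrite <- Hfin in Hub. exact Hub.
Qed.

Lemma disk_sup_least (F : C -> R) (K : R) :
  (forall z, in_disk z -> (1 - Cmod z ^ 2) * F z <= K) ->
  is_finite (disk_sup F) /\ real (disk_sup F) <= K.
Proof.
  intros HK. destruct (Lub_Rbar_correct (fun x : R =>
    exists z : C, in_disk z /\ x = (1 - Cmod z ^ 2) * F z)) as [Hub Hleast].
  fold (disk_sup F) in Hub, Hleast.
  specialize (Hub _ (ex_intro _ (RtoC 0) (conj in_disk_0 eq_refl))).
  specialize (Hleast (Finite K)).
  assert (HK' : Rbar_le (disk_sup F) K).
  { apply Hleast. intros x [z [Hz ->]]. now apply HK. }
  destruct (disk_sup F); simpl in *; try contradiction.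
  split; [reflexivity|exact HK'].
Qed.

Lemma disk_sup_shift (F G : C -> R) (K : R) :
  is_finite (disk_sup F) ->
  (forall z, in_disk z -> (1 - Cmod z ^ 2) * G z <= (1 - Cmod z ^ 2) * F z + K) ->
  is_finite (disk_sup G) /\ real (disk_sup G) <= real (disk_sup F) + K.
Proof.
  intros HF H. apply disk_sup_least. intros z Hz.
  pose proof (H z Hz). pose proof (disk_sup_upper F z HF Hz). lra.
Qed.

Lemma beta_log_finite (h g : C -> C) :
  is_finite (beta_f h g) -> is_finite (beta_log g).
Proof.
  intros H. apply (disk_sup_shift _ _ 0 H). intros z Hz.
  rewrite Rplus_0_r. apply Rmult_le_compat_l; [apply Rlt_le, disk_weight_pos, Hz|].
  pose proof (Cmod_ge_0 (C_derive h z / h z)%C). lra.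
Qed.

Lemma Cmod_minus_swap (a b : C) : Cmod (a - b)%C = Cmod (b - a)%C.
Proof. rewrite <- Cmod_opp. f_equal. ring. Qed.

Lemma Cmod_le_plus_dist (a b : C) : Cmod a <= Cmod b + Cmod (a - b)%C.
Proof.
  replace a with (b + (a - b))%C at 1 by ring. apply Cmod_triangle.
Qed.

(** By Schwarz-Pick the left-hand side is at most [|w z|], which is below 1. *)
Lemma dilatation_term_bound (w : C -> C) (z : C) :
  analytic_disk w -> (forall z, in_disk z -> in_disk (w z)) -> in_disk z ->
  (1 - Cmod z ^ 2)
    * Cmod (Cconj (w z) * C_derive w z / RtoC (1 - Cmod (w z) ^ 2)%R)%C <= 1.
Proof.
  intros Hw Hdisk Hz.
  assert (Hwz := disk_weight_pos _ (Hdisk z Hz)).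
  assert (D : forall y, in_disk y -> is_C_derive w y (C_derive w y)).
  { intros y Hy. apply C_derive_correct; [exact y|]. now apply Hw. }
  pose proof (schwarz_pick w z (C_derive w z)
    (fun y Hy => ex_intro _ _ (D y Hy)) Hdisk Hz (D z Hz)) as P.
  rewrite Cmod_div by (intros E; apply RtoC_inj in E; lra).
  rewrite Cmod_mult, Cmod_conj, Cmod_R, Rabs_pos_eq by lra.
  unfold Rdiv. rewrite <- Rmult_assoc. apply Rle_div_l; [exact Hwz|].
  pose proof (Hdisk z Hz) as Hd. unfold in_disk in Hd.
  pose proof (Cmod_ge_0 (w z)). pose proof (Cmod_ge_0 (C_derive w z)).
  pose proof (disk_weight_pos z Hz).
  assert (0 <= (1 - Cmod z ^ 2) * Cmod (C_derive w z)) by (apply Rmult_le_pos; lra).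
  nra.
Qed.

Lemma preSchwarzian_distance (h g w : C -> C) (z : C) :
  logharmonic_bloch h g w -> in_disk z ->
  (1 - Cmod z ^ 2)
    * Cmod (preSchwarzian_logharm h g w z - preSchwarzian_analytic h z)%C
  <= real (beta_log g) + 1.
Proof.
  intros [Hlh Hfin] Hz.
  pose proof (dilatation_term_bound w z (lh_analytic_w _ _ _ Hlh)
    (lh_w_disk _ _ _ Hlh) Hz) as B1.
  pose proof (disk_sup_upper _ z (beta_log_finite h g Hfin) Hz) as B2.
  fold (beta_log g) in B2. cbv beta in B2.
  pose proof (disk_weight_pos z Hz).
  unfold preSchwarzian_logharm, preSchwarzian_analytic.
  set (p := (C_derive (C_derive h) z / C_derive h z)%C) in *.
  set (q := (C_derive g z / g z)%C) in *.
  set (r := (Cconj (w z) * C_derive w z / RtoC (1 - Cmod (w z) ^ 2))%C) in *.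
  replace (p + q - r - p)%C with (q + - r)%C by ring.
  pose proof (Cmod_triangle q (- r)%C) as T. rewrite Cmod_opp in T. nra.
Qed.

Lemma preSchwarzian_norm_comparison (h g w : C -> C) :
  logharmonic_bloch h g w ->
  (is_finite (preSchwarzian_norm (preSchwarzian_logharm h g w)) <->
   is_finite (preSchwarzian_norm (preSchwarzian_analytic h))) /\
  (is_finite (preSchwarzian_norm (preSchwarzian_analytic h)) ->
   Rabs (real (preSchwarzian_norm (preSchwarzian_logharm h g w))
         - real (preSchwarzian_norm (preSchwarzian_analytic h)))
   <= real (beta_log g) + 1).
Proof.
  intros Hb. unfold preSchwarzian_norm.
  assert (T : forall P Q : C -> C,
    (forall z, in_disk z ->
       (1 - Cmod z ^ 2) * Cmod (P z - Q z)%C <= real (beta_log g) + 1) ->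
    forall z, in_disk z ->
       (1 - Cmod z ^ 2) * Cmod (P z) <= (1 - Cmod z ^ 2) * Cmod (Q z)
         + (real (beta_log g) + 1)).
  { intros P Q H z Hz. specialize (H z Hz). pose proof (disk_weight_pos z Hz).
    pose proof (Cmod_le_plus_dist (P z) (Q z)). nra. }
  assert (Up := T _ _ (fun z => preSchwarzian_distance h g w z Hb)).
  assert (Lo : forall z, in_disk z ->
       (1 - Cmod z ^ 2) * Cmod (preSchwarzian_analytic h z)
       <= (1 - Cmod z ^ 2) * Cmod (preSchwarzian_logharm h g w z)
         + (real (beta_log g) + 1)).
  { apply T. intros z Hz. rewrite Cmod_minus_swap. now apply preSchwarzian_distance. }
  split; [split|]; intros H.
  - apply (disk_sup_shift _ _ _ H Lo).
  - apply (disk_sup_shift _ _ _ H Up).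
  - destruct (disk_sup_shift _ _ _ H Up) as [H' U].
    destruct (disk_sup_shift _ _ _ H' Lo) as [_ L].
    apply Rabs_le. lra.
Qed.

(** * A family showing that the constant 1 is optimal *)

(** With [h = exp (e z)], [g = exp (e z^2 / 2)] and [w = z], the dilatation term is
    the conjugate of [z] over [1 - |z|^2], of norm exactly 1, while [h'/h = e] and
    [g'/g = e z] become negligible as [e] tends to 0. *)
Definition extremal_h (e : R) (z : C) : C := Cexp (RtoC e * z)%C.
Definition extremal_g (e : R) (z : C) : C := Cexp (RtoC (e / 2) * (z * z))%C.

Lemma is_C_derive_extremal_h (e : R) (z : C) :
  is_C_derive (extremal_h e) z (RtoC e * extremal_h e z)%C.
Proof.
  apply (is_C_derive_comp Cexp (fun z => RtoC e * z)%C); [apply is_C_derive_Cexp|].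
  apply (is_C_derive_ext (fun z => RtoC e * z + RtoC 0)%C);
    [intros; ring|apply is_C_derive_affine].
Qed.

Lemma is_C_derive_extremal_g (e : R) (z : C) :
  is_C_derive (extremal_g e) z (RtoC e * z * extremal_g e z)%C.
Proof.
  apply (is_C_derive_comp Cexp (fun z => RtoC (e / 2) * (z * z))%C);
    [apply is_C_derive_Cexp|].
  pose proof (is_C_derive_mult _ _ z _ _ (is_C_derive_const (RtoC (e / 2)) z)
    (is_C_derive_mult _ _ z _ _ (is_C_derive_id z) (is_C_derive_id z))) as H.
  cbv beta in H.
  replace (RtoC e * z)%C with
    (RtoC 0 * (z * z) + RtoC (e / 2) * (RtoC 1 * z + z * RtoC 1))%C; [exact H|].
  replace (RtoC e) with (RtoC (e / 2) + RtoC (e / 2))%C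
    by (rewrite <- RtoC_plus; f_equal; field).
  ring.
Qed.

Lemma C_derive_extremal_h (e : R) (z : C) : C_derive (extremal_h e) z = (RtoC e * extremal_h e z)%C.
Proof. apply is_C_derive_unique, is_C_derive_extremal_h. Qed.

Lemma C_derive_extremal_g (e : R) (z : C) :
  C_derive (extremal_g e) z = (RtoC e * z * extremal_g e z)%C.
Proof. apply is_C_derive_unique, is_C_derive_extremal_g. Qed.

Lemma C_derive2_extremal_h (e : R) (z : C) :
  C_derive (C_derive (extremal_h e)) z = (RtoC e * (RtoC e * extremal_h e z))%C.
Proof.
  apply is_C_derive_unique.
  apply (is_C_derive_ext (fun y => RtoC e * extremal_h e y)%C);
    [intros; symmetry; apply C_derive_extremal_h|].
  pose proof (is_C_derive_mult _ _ z _ _ (is_C_derive_const (RtoC e) z)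
    (is_C_derive_extremal_h e z)) as H. cbv beta in H.
  replace (RtoC e * (RtoC e * extremal_h e z))%C with
    (RtoC 0 * extremal_h e z + RtoC e * (RtoC e * extremal_h e z))%C by ring. exact H.
Qed.

Lemma C_derive_id_value (z : C) : C_derive (fun y => y) z = RtoC 1.
Proof. apply is_C_derive_unique, is_C_derive_id. Qed.

Lemma in_disk_coordinates (x y : R) : in_disk (x, y) -> x ^ 2 + y ^ 2 < 1.
Proof.
  unfold in_disk. intros Hz. pose proof (Cmod2_alt (x, y)) as E.
  simpl Re in E. simpl Im in E. pose proof (Cmod_ge_0 (x, y)). rewrite <- E. nra.
Qed.

Lemma Cconj_Cexp (z : C) : Cconj (Cexp z) = Cexp (Cconj z).
Proof. destruct z. unfold Cconj, Cexp; simpl. rewrite cos_neg, sin_neg. f_equal; ring. Qed.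

Lemma logharm_extremal (e x y : R) :
  logharm (extremal_h e) (extremal_g e) (x, y) =
  Cexp (e * (x + (x ^ 2 - y ^ 2) / 2), e * (y - x * y)).
Proof.
  unfold logharm, extremal_h, extremal_g. rewrite Cconj_Cexp, <- Cexp_plus. f_equal.
  unfold Cplus, Cmult, Cconj; simpl. f_equal; field.
Qed.

Lemma Cexp_inj (z w : C) :
  Rabs (snd z) < PI / 2 -> Rabs (snd w) < PI / 2 -> Cexp z = Cexp w -> z = w.
Proof.
  intros Hz Hw E. apply Rabs_def2 in Hz, Hw.
  assert (E1 : fst z = fst w).
  { apply exp_inv. rewrite <- !Cmod_Cexp. now rewrite E. }
  destruct z as [a b], w as [c d]. simpl in *. subst c. f_equal.
  injection E as _ E2. pose proof (exp_pos a) as Hp.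
  apply Rmult_eq_reg_l in E2; [|lra].
  destruct (Rtotal_order b d) as [h|[h|h]]; [|exact h|].
  - pose proof (sin_increasing_1 b d ltac:(lra) ltac:(lra) ltac:(lra) ltac:(lra) h). lra.
  - pose proof (sin_increasing_1 d b ltac:(lra) ltac:(lra) ltac:(lra) ltac:(lra) h). lra.
Qed.

(** For small [e] the argument of the exponential in [logharm_extremal] stays in a
    strip where the exponential is injective, and [z + conj(z)^2 / 2] is injective
    on the disk. *)
Lemma logharm_extremal_injective (e : R) (u v : C) :
  0 < e <= 1 / 4 -> in_disk u -> in_disk v ->
  logharm (extremal_h e) (extremal_g e) u = logharm (extremal_h e) (extremal_g e) v -> u = v.
Proof.
  intros He Hu Hv E.
  assert (Bd : forall z : C, in_disk z ->
     Rabs (e * (snd z - fst z * snd z)) < PI / 2 /\ fst z ^ 2 + snd z ^ 2 < 1).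
  { intros [x y] Hz. pose proof (in_disk_coordinates x y Hz) as Hxy.
    split; [|exact Hxy]. simpl. pose proof PI2_1.
    assert (Bx : -1 < x < 1) by (split; nra).
    assert (By : -1 < y < 1) by (split; nra).
    assert (-2 < y - x * y < 2) by (split; nra).
    apply Rabs_def1; nra. }
  destruct (Bd u Hu) as [U1 U2], (Bd v Hv) as [V1 V2].
  destruct u as [x y], v as [s t]. rewrite !logharm_extremal in E.
  apply Cexp_inj in E; [|exact U1|exact V1]. simpl in U2, V2.
  injection E as E1 E2.
  apply Rmult_eq_reg_l in E1; [|lra]. apply Rmult_eq_reg_l in E2; [|lra].
  (* Equal values give [2 (u - v) = - conj ((u - v) (u + v))], where [|u + v| < 2];
     [S] compares the squared moduli. *)
  assert (F1 : 2 * (x - s) = - ((x - s) * (x + s) - (y - t) * (y + t))) by nra.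
  assert (F2 : 2 * (y - t) = (x - s) * (y + t) + (y - t) * (x + s)) by nra.
  assert (S : 4 * ((x - s) ^ 2 + (y - t) ^ 2)
     = ((x - s) ^ 2 + (y - t) ^ 2) * ((x + s) ^ 2 + (y + t) ^ 2)).
  { transitivity ((2 * (x - s)) ^ 2 + (2 * (y - t)) ^ 2); [ring|].
    rewrite F1, F2. ring. }
  pose proof (pow2_ge_0 (x - s)). pose proof (pow2_ge_0 (y - t)).
  assert (P : (x + s) ^ 2 + (y + t) ^ 2 < 4) by lra.
  assert (Z : (x - s) ^ 2 + (y - t) ^ 2 = 0) by nra.
  f_equal; apply Rminus_diag_uniq; apply Rsqr_0_uniq; unfold Rsqr; lra.
Qed.

Lemma jacobian_logharm_extremal (e : R) (z : C) :
  0 < e -> in_disk z -> 0 < jacobian (logharm (extremal_h e) (extremal_g e)) z.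
Proof.
  intros He Hz. destruct z as [x y].
  set (a := fun x y => e * (x + (x ^ 2 - y ^ 2) / 2)).
  set (b := fun x y => e * (y - x * y)).
  pose proof (in_disk_coordinates x y Hz) as Hxy.
  unfold jacobian. cbv zeta. simpl fst at 1.
  rewrite (Derive_ext (fun t => fst (logharm (extremal_h e) (extremal_g e) (t, snd (x, y))))
    (fun t => exp (a t y) * cos (b t y)))
    by (intros; rewrite logharm_extremal; reflexivity).
  rewrite (Derive_ext (fun t => fst (logharm (extremal_h e) (extremal_g e) (fst (x, y), t)))
    (fun t => exp (a x t) * cos (b x t)))
    by (intros; rewrite logharm_extremal; reflexivity).
  rewrite (Derive_ext (fun t => snd (logharm (extremal_h e) (extremal_g e) (t, snd (x, y))))
    (fun t => exp (a t y) * sin (b t y)))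
    by (intros; rewrite logharm_extremal; reflexivity).
  rewrite (Derive_ext (fun t => snd (logharm (extremal_h e) (extremal_g e) (fst (x, y), t)))
    (fun t => exp (a x t) * sin (b x t)))
    by (intros; rewrite logharm_extremal; reflexivity).
  cbn [fst snd].
  set (E := exp (a x y)). set (c := cos (b x y)). set (s := sin (b x y)).
  assert (D1 : Derive (fun t => exp (a t y) * cos (b t y)) x
     = E * (e * (1 + x) * c + e * y * s)).
  { apply is_derive_unique. unfold a, b, E, c, s. auto_derive; [exact I|].
    unfold a, b, Rminus, Rdiv. cbn [pow]. field. }
  assert (D2 : Derive (fun t => exp (a x t) * cos (b x t)) y
     = E * (- (e * y) * c - e * (1 - x) * s)).
  { apply is_derive_unique. unfold a, b, E, c, s. auto_derive; [exact I|].
    unfold a, b, Rminus, Rdiv. cbn [pow]. field. }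
  assert (D3 : Derive (fun t => exp (a t y) * sin (b t y)) x
     = E * (e * (1 + x) * s - e * y * c)).
  { apply is_derive_unique. unfold a, b, E, c, s. auto_derive; [exact I|].
    unfold a, b, Rminus, Rdiv. cbn [pow]. field. }
  assert (D4 : Derive (fun t => exp (a x t) * sin (b x t)) y
     = E * (- (e * y) * s + e * (1 - x) * c)).
  { apply is_derive_unique. unfold a, b, E, c, s. auto_derive; [exact I|].
    unfold a, b, Rminus, Rdiv. cbn [pow]. field. }
  rewrite D1, D2, D3, D4.
  assert (Hcs : s * s + c * c = 1) by apply (sin2_cos2 (b x y)).
  replace (_ - _) with (E * E * (e * e) * (1 - x ^ 2 - y ^ 2) * (s * s + c * c)) by ring.
  rewrite Hcs. assert (0 < E) by apply exp_pos.
  repeat apply Rmult_lt_0_compat; lra.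
Qed.

Lemma RtoC_neq_0 (e : R) : e <> 0 -> RtoC e <> RtoC 0.
Proof. intros He E. now apply He, RtoC_inj. Qed.

Lemma log_derivative_extremal_h (e : R) (z : C) :
  (C_derive (extremal_h e) z / extremal_h e z)%C = RtoC e.
Proof. rewrite C_derive_extremal_h. field. apply Cexp_neq_0. Qed.

Lemma log_derivative_extremal_g (e : R) (z : C) :
  (C_derive (extremal_g e) z / extremal_g e z)%C = (RtoC e * z)%C.
Proof. rewrite C_derive_extremal_g. field. apply Cexp_neq_0. Qed.

Lemma preSchwarzian_extremal_h (e : R) (z : C) :
  e <> 0 -> preSchwarzian_analytic (extremal_h e) z = RtoC e.
Proof.
  intros He. unfold preSchwarzian_analytic. rewrite C_derive2_extremal_h, C_derive_extremal_h.
  field. split; [apply Cexp_neq_0|now apply RtoC_neq_0].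
Qed.

Lemma logharmonic_bloch_extremal (e : R) :
  0 < e <= 1 / 4 -> logharmonic_bloch (extremal_h e) (extremal_g e) (fun z => z).
Proof.
  intros He. split; [constructor|].
  - intros z _. eexists. apply is_C_derive_extremal_h.
  - intros z _. eexists. apply is_C_derive_extremal_g.
  - intros z _. apply Cexp_neq_0.
  - intros z _. apply Cexp_neq_0.
  - intros z _. eexists. apply is_C_derive_id.
  - auto.
  - intros z _. rewrite log_derivative_extremal_g, log_derivative_extremal_h. ring.
  - intros z _. exists 1. split; [lra|]. intros u v Hu Hv _ _.
    now apply logharm_extremal_injective.
  - intros z Hz. now apply jacobian_logharm_extremal.
  - apply (disk_sup_least _ (2 * e)). intros z Hz.
    rewrite log_derivative_extremal_h, log_derivative_extremal_g, Cmod_mult, Cmod_R, Rabs_pos_eq by lra.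
    pose proof (disk_weight_pos z Hz). unfold in_disk in Hz. pose proof (Cmod_ge_0 z).
    assert (e + e * Cmod z <= 2 * e) by nra.
    assert (1 - Cmod z ^ 2 <= 1) by nra. nra.
Qed.

Lemma beta_log_extremal_g (e : R) : 0 < e -> real (beta_log (extremal_g e)) <= e.
Proof.
  intros He. apply disk_sup_least. intros z Hz.
  rewrite log_derivative_extremal_g, Cmod_mult, Cmod_R, Rabs_pos_eq by lra.
  pose proof (disk_weight_pos z Hz). unfold in_disk in Hz. pose proof (Cmod_ge_0 z).
  assert (e * Cmod z <= e) by nra. assert (1 - Cmod z ^ 2 <= 1) by nra. nra.
Qed.

Lemma preSchwarzian_norm_extremal_h (e : R) :
  0 < e ->
  is_finite (preSchwarzian_norm (preSchwarzian_analytic (extremal_h e))) /\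
  real (preSchwarzian_norm (preSchwarzian_analytic (extremal_h e))) <= e.
Proof.
  intros He. apply disk_sup_least. intros z Hz.
  rewrite preSchwarzian_extremal_h, Cmod_R, Rabs_pos_eq by lra.
  assert (0 <= Cmod z ^ 2) by apply pow2_ge_0. nra.
Qed.

(** At the real point [r] the dilatation term contributes [r] to the weighted
    modulus and the other two at most [2 e (1 - r^2)]; [r = 1 - e] makes the total
    loss at most [2 e]. *)
Lemma preSchwarzian_norm_logharm_extremal (e : R) :
  0 < e <= 1 / 4 ->
  is_finite (preSchwarzian_norm (preSchwarzian_logharm (extremal_h e) (extremal_g e) (fun z => z))) ->
  1 - 2 * e <=
  real (preSchwarzian_norm (preSchwarzian_logharm (extremal_h e) (extremal_g e) (fun z => z))).
Proof.
  intros He Hfin. set (r := 1 - e).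
  assert (Hmr : Cmod (RtoC r) = r) by (rewrite Cmod_R; apply Rabs_pos_eq; unfold r; lra).
  assert (Hr : in_disk (RtoC r)) by (unfold in_disk; rewrite Hmr; unfold r; lra).
  eapply Rle_trans; [|apply (disk_sup_upper _ _ Hfin Hr)].
  pose proof (disk_weight_pos _ Hr) as Hw.
  assert (Val : preSchwarzian_logharm (extremal_h e) (extremal_g e) (fun z => z) (RtoC r)
    = RtoC (e + e * r - r / (1 - r ^ 2))).
  { unfold preSchwarzian_logharm.
    fold (preSchwarzian_analytic (extremal_h e) (RtoC r)).
    rewrite preSchwarzian_extremal_h, log_derivative_extremal_g, C_derive_id_value, Hmr by lra.
    rewrite Hmr in Hw.
    rewrite (RtoC_minus (e + e * r)), (RtoC_plus e), (RtoC_mult e), RtoC_div by lra.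
    replace (Cconj (RtoC r)) with (RtoC r) by (unfold Cconj, RtoC; simpl; f_equal; ring).
    rewrite Cmult_1_r. reflexivity. }
  rewrite Val, Hmr, Cmod_R. rewrite Hmr in Hw.
  apply Rle_trans with ((1 - r ^ 2) * (r / (1 - r ^ 2) - (e + e * r))).
  - replace ((1 - r ^ 2) * (r / (1 - r ^ 2) - (e + e * r)))
      with (r - (1 - r ^ 2) * (e + e * r)) by (field; lra).
    unfold r. nra.
  - apply Rmult_le_compat_l; [lra|].
    rewrite <- Rabs_Ropp. eapply Rle_trans; [|apply Rle_abs]. lra.
Qed.

Theorem theorem3p4 :
  (forall h g w : C -> C, logharmonic_bloch h g w ->
     (is_finite (preSchwarzian_norm (preSchwarzian_logharm h g w)) <->
      is_finite (preSchwarzian_norm (preSchwarzian_analytic h))) /\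
     (is_finite (preSchwarzian_norm (preSchwarzian_analytic h)) ->
      Rabs (real (preSchwarzian_norm (preSchwarzian_logharm h g w))
            - real (preSchwarzian_norm (preSchwarzian_analytic h)))
      <= real (beta_log g) + 1)) /\
  (forall c : R, c < 1 ->
     exists h g w : C -> C,
       logharmonic_bloch h g w /\
       is_finite (preSchwarzian_norm (preSchwarzian_analytic h)) /\
       real (beta_log g) + c <
       Rabs (real (preSchwarzian_norm (preSchwarzian_logharm h g w))
             - real (preSchwarzian_norm (preSchwarzian_analytic h)))).
Proof.
  split; [exact preSchwarzian_norm_comparison|].
  (* The difference of norms is at least [1 - 3 e] and [beta_log] at most [e], so
     [4 e < 1 - c] suffices. *)
  intros c Hc. set (e := Rmin (1 / 4) ((1 - c) / 8)).
  assert (He : 0 < e <= 1 / 4)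
    by (split; [apply Rmin_pos; lra | apply Rmin_l]).
  assert (Hec : e <= (1 - c) / 8) by apply Rmin_r.
  exists (extremal_h e), (extremal_g e), (fun z => z).
  pose proof (logharmonic_bloch_extremal e He) as Hb.
  destruct (preSchwarzian_norm_extremal_h e (proj1 He)) as [Hfin Hh].
  split; [exact Hb|]. split; [exact Hfin|].
  pose proof (proj2 (proj1 (preSchwarzian_norm_comparison _ _ _ Hb)) Hfin) as Hfin'.
  pose proof (preSchwarzian_norm_logharm_extremal e He Hfin').
  pose proof (beta_log_extremal_g e (proj1 He)).
  eapply Rlt_le_trans; [|apply Rle_abs]. lra.
Qed.
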